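(* For a semigroup $S$, the following are equivalent: (1) The proper IP sets in $S$ are partition regular: for every proper IP set $A\subseteq S$ and every partition of $A$ into finitely many pieces, some piece is a proper IP set. (2) Every bijective (injective) sequence in $S$ has a proper sumsequence. (3) $S$ has no subsemigroup isomorphic to (or of) any of the following types: (a) an infinite semigroup $S'$ such that $S'+S'$ is finite; (b) the fan semilattice, i.e. $\mathbb N$ with the operation $m\wedge n:=1$ for distinct $m,n$ and $n\wedge n:=n$; (c) the semigroup $(\mathbb N\times\mathbb N)\cup\{0\}$ with $0+x=x+0:=0$ for all $x$, and $(m_1,n_1)+(m_2,n_2):=(m_1,n_1+n_2)$ if $m_1=m_2$, and $:=0$ otherwise. (4) For every bijective sequence $a_1,a_2,\dotsc$ in $S$ and every finite coloring of $S$, there is a bijective sumsequence $b_1,b_2,\dotsc$ of it such that $\mathrm{FS}(b_1,b_2,\dotsc)$ is monochromatic. (5) For every bijective sequence $a_1,a_2,\dotsc$ in $S$ and every finite coloring of $S$, there is a proper sumsequence $b_1,b_2,\dotsc$ of it such that $\mathrm{FS}(b_1,b_2,\dotsc)$ is monochromatic.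
   Context: Semigroups are written additively and are not assumed commutative. For a sequence $a_1,a_2,\dotsc$, $\mathrm{FS}(a_1,a_2,\dotsc):=\{a_{i_1}+\dotsb+a_{i_m}: m\ge1,\ i_1<\dotsb<i_m\}$. A proper IP set is a set containing $\mathrm{FS}(b_1,b_2,\dotsc)$ for some bijective (injective) sequence $b_1,b_2,\dotsc$. For a finite nonempty index set $F=\{i_1<\dotsb<i_m\}$, $a_F:=a_{i_1}+\dotsb+a_{i_m}$; $F_1<F_2$ means every element of $F_1$ is smaller than every element of $F_2$. A sumsequence of $a_1,a_2,\dotsc$ is a sequence $a_{F_1},a_{F_2},\dotsc$ for nonempty finite index sets $F_1<F_2<\dotsb$. A sequence is proper if $a_{F_1}\ne a_{F_2}$ for all nonempty finite $F_1<F_2$. A finite coloring is a map into a finite set; a set is monochromatic if the coloring is constant on it. *)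

(* Defs.v *)
From Stdlib Require Import List.
From mathcomp Require Import all_boot.
Set Implicit Arguments. Unset Strict Implicit. Unset Printing Implicit Defensive.

Section SemigroupDefs.
Variables (S : Type) (op : S -> S -> S).

(* A nonempty finite index set {i_1 < ... < i_m} is represented by
   (i_1, [:: i_2; ...; i_m]) with strictly increasing entries. *)
Definition blk := (nat * seq nat)%type.
Definition valid_blk (F : blk) : bool := path ltn F.1 F.2.
Definition blk_max (F : blk) : nat := last F.1 F.2.
Definition blk_lt (F G : blk) : bool := blk_max F < G.1.

Definition blk_sum (a : nat -> S) (F : blk) : S :=
  foldl (fun acc j => op acc (a j)) (a F.1) F.2.

Definition FS (a : nat -> S) : S -> Prop :=
  fun x => exists F : blk, valid_blk F /\ x = blk_sum a F.

Definition proper_IP_set (A : S -> Prop) : Prop :=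
  exists b : nat -> S, injective b /\ (forall x, FS b x -> A x).

Definition sumseq_blocks (F : nat -> blk) : Prop :=
  (forall n, valid_blk (F n)) /\ (forall n, blk_lt (F n) (F n.+1)).

Definition sumseq (a : nat -> S) (F : nat -> blk) : nat -> S :=
  fun n => blk_sum a (F n).

Definition proper_seq (a : nat -> S) : Prop :=
  forall F G : blk, valid_blk F -> valid_blk G -> blk_lt F G ->
    blk_sum a F <> blk_sum a G.

Definition monochromatic (C : Type) (c : S -> C) (A : S -> Prop) : Prop :=
  forall x y, A x -> A y -> c x = c y.

Definition subsemigroup (T : S -> Prop) : Prop :=
  forall x y, T x -> T y -> T (op x y).

Definition finite_set (T : S -> Prop) : Prop :=
  exists l : list S, forall x, T x -> In x l.

Definition has_sub_type_a : Prop :=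
  exists T : S -> Prop, subsemigroup T /\ ~ finite_set T /\
    finite_set (fun z => exists x y, T x /\ T y /\ z = op x y).

End SemigroupDefs.

(* Fan semilattice on N = {1,2,...}: m ^ n := 1 for m <> n, n ^ n := n. *)
Definition fan_op (m n : nat) : nat := if m == n then n else 1.

(* S has a subsemigroup isomorphic to the fan semilattice, i.e. there is an
   injective homomorphism from ({1,2,...}, fan_op) into S. *)
Definition has_sub_fan (S : Type) (op : S -> S -> S) : Prop :=
  exists f : nat -> S,
    (forall m n, 0 < m -> 0 < n -> f m = f n -> m = n) /\
    (forall m n, 0 < m -> 0 < n -> f (fan_op m n) = op (f m) (f n)).

(* The semigroup (N x N) u {0}, with N = {1,2,...}; 0 is represented by None. *)
Definition c_op (x y : option (nat * nat)) : option (nat * nat) :=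
  match x, y with
  | Some (m1, n1), Some (m2, n2) => if m1 == m2 then Some (m1, n1 + n2) else None
  | _, _ => None
  end.
Definition c_dom (x : option (nat * nat)) : bool :=
  match x with None => true | Some (m, n) => (0 < m) && (0 < n) end.

Definition has_sub_C (S : Type) (op : S -> S -> S) : Prop :=
  exists f : option (nat * nat) -> S,
    (forall x y, c_dom x -> c_dom y -> f x = f y -> x = y) /\
    (forall x y, c_dom x -> c_dom y -> f (c_op x y) = op (f x) (f y)).

(* Main.v *)
(* The hard implication is from the absence of the three types of subsemigroups
   to proper monochromatic sumsequences.  In the compact semigroup of the
   ultrafilters containing all tails FS(a_n, a_{n+1}, ...), a nonprincipal
   idempotent yields a proper monochromatic sumsequence by the Galvin-Glazer
   argument.  If there is none, take a closed subsemigroup M minimal among those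
   containing a nonprincipal ultrafilter, and a nonprincipal p in M: then M p has
   only principal elements, so all powers p^k with k >= 2 are elements z_k of S,
   finitely many in number.  Choosing x_1, x_2, ... generic for p gives
   x_m x_n = z_2 for m < n and, unless type (a) already appears among the products
   t s or their p-limits, x_n x_m = r for n > m.  A suitable power x_n^N then
   takes infinitely many values with pairwise products a common zero, which gives
   (a), (b) or (c), or only finitely many values, which gives (a). *)
From Stdlib Require Import List.
From Stdlib Require FinFun.
Require Import Defs.
From mathcomp Require Import all_boot zify.
From mathcomp Require Import boolp classical_sets filter.
Set Implicit Arguments. Unset Strict Implicit. Unset Printing Implicit Defensive.

(** * Extraction of sequences and subsequences *)

Section Sequences.
Variable T : Type.

Lemma injective_lt (x : nat -> T) :
  (forall i j, i < j -> x i <> x j) -> injective x.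
Proof.
move=> h i j e; case: (ltngtP i j) => // lt; first by case: (h _ _ lt).
by case: (h _ _ lt).
Qed.

(** Dependent choice against the list of all earlier terms, so that [R] links every pair of indices
    and not only consecutive ones. *)
Lemma chain_exists (P : T -> Prop) (R : T -> T -> Prop) :
    (forall l : list T, (forall y, In y l -> P y) ->
       exists x, P x /\ forall y, In y l -> R y x) ->
  exists x : nat -> T, (forall n, P (x n)) /\
    forall i j, i < j -> R (x i) (x j).
Proof.
move=> ext.
have [x0 _] : exists x, P x /\ forall y, In y [::] -> R y x by apply: ext.
have {}ext (l : list T) : exists x, (forall y, In y l -> P y) ->
    P x /\ forall y, In y l -> R y x.
  have [h|h] := pselect (forall y, In y l -> P y); last by exists x0.
  by have [x hx] := ext _ h; exists x.
have [next hnext] := choice ext.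
pose h := fix h n := if n is n'.+1 then next (h n') :: h n' else [::].
have hP n : forall y, In y (h n) -> P y.
  elim: n => [|n IH] y //= [<-|]; last exact: IH.
  exact: (hnext _ IH).1.
have hin i j : i < j -> In (next (h i)) (h j).
  elim: j => // j IH; rewrite ltnS leq_eqVlt => /orP[/eqP->|/IH]; first by left.
  by right.
exists (fun n => next (h n)); split=> [n|i j ij]; first exact: (hnext _ (hP n)).1.
exact: (hnext _ (hP j)).2 (hin _ _ ij).
Qed.

Lemma nat_list_bound (l : list nat) : exists m, forall i, In i l -> i <= m.
Proof.
elim: l => [|a l [m hm]]; first by exists 0.
exists (maxn a m) => i /= [<-|/hm]; first exact: leq_maxl.
by move=> h; apply: leq_trans h (leq_maxr _ _).
Qed.

Lemma infinite_pigeonhole (y : nat -> T) (l : list T) (Q : nat -> Prop) :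
    (forall m, exists n, m < n /\ Q n) -> (forall n, Q n -> In (y n) l) ->
  exists v, forall m, exists n, m < n /\ y n = v.
Proof.
elim: l Q => [|v l IH] Q hQ hl.
  by have [n [_ /hl]] := hQ 0.
have [h|/existsNP[m0 /forallNP h]] :=
  pselect (forall m, exists n, m < n /\ y n = v); first by exists v.
apply: (IH (fun n => m0 < n /\ Q n)) => [m|n [mn /hl /= [e|//]]].
  have [n [mn Qn]] := hQ (maxn m m0); exists n.
  by split; [|split=> //]; lia.
by case: (h n).
Qed.
End Sequences.

(** A finite range repeats some value infinitely often; an infinite one always supplies a new value.
    [f] is injective rather than increasing because the relations it will transport concern any two
    distinct indices. *)
Lemma subseq_injective_or_constant (T : Type) (y : nat -> T) :
  exists f : nat -> nat, injective f /\
    (injective (y \o f) \/ forall n, y (f n) = y (f 0)).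
Proof.
have [[l hl]|fin] := pselect (exists l, forall n, In (y n) l).
  have [v hv] : exists v, forall m, exists n, m < n /\ y n = v.
    apply: (@infinite_pigeonhole T y l (fun=> True)) => // m.
    by exists m.+1.
  have [l' _|f [hP hR]] := @chain_exists nat (fun n => y n = v) (fun i j => i < j).
    have [m hm] := nat_list_bound l'; have [n [mn yn]] := hv m.
    by exists n; split=> // i /hm im; apply: leq_ltn_trans im mn.
  exists f; split; last by right=> n; rewrite !hP.
  by apply: injective_lt => i j /hR; lia.
have [l' _|f [_ hR]] :=
    @chain_exists nat (fun=> True) (fun i j => y i <> y j).
  have /existsNP[n hn] : ~ forall n, In (y n) (List.map y l').
    by move=> h; apply: fin; exists (List.map y l').
  by exists n; split=> // i hi e; apply: hn; rewrite -e; apply: in_map.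
exists f; split; last by left; apply: injective_lt.
by apply: injective_lt => i j /hR h e; apply: h; rewrite e.
Qed.

(** * Finite sets *)

Section Finite.
Variable T : Type.
Implicit Types A B : T -> Prop.

Lemma finite_sub A B : (forall x, A x -> B x) -> finite_set B -> finite_set A.
Proof. by move=> AB [l hl]; exists l => x /AB/hl. Qed.

Lemma finite_set1 (x : T) : finite_set (fun y => y = x).
Proof. by exists [:: x] => y ->; left. Qed.

Lemma finite_setU A B :
  finite_set A -> finite_set B -> finite_set (fun x => A x \/ B x).
Proof.
by move=> [l hl] [k hk]; exists (l ++ k)%list => x h; apply/in_app_iff;
  case: h => [/hl|/hk]; [left|right].
Qed.

Lemma finite_bigcup (A : nat -> T -> Prop) n :
    (forall i, i < n -> finite_set (A i)) ->
  finite_set (fun x => exists i, i < n /\ A i x).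
Proof.
elim: n => [_|n IH hA]; first by exists [::] => x [i []].
apply: finite_sub (finite_setU (IH _) (hA n _)) => // [x [i [lt hi]]|i lt].
  move: lt; rewrite ltnS leq_eqVlt => /orP[/eqP e|lt]; first by right; rewrite -e.
  by left; exists i.
by apply: hA; apply: leq_trans lt _.
Qed.

Lemma periodic_range_finite (z : nat -> T) i j :
    i < j -> (forall k, i <= k -> z (k + (j - i)) = z k) ->
  finite_set (fun x => exists k, x = z k).
Proof.
move=> ij hz; exists (List.map z (List.seq 0 j)) => x [k ->]; apply/in_map_iff.
elim/ltn_ind: k => k IH; case: (ltnP k j) => kj.
  by exists k; split=> //; apply/in_seq; lia.
have [|k' [e hk']] := IH (k - (j - i)); first by lia.
exists k'; split=> //; rewrite e -[in RHS](_ : k - (j - i) + (j - i) = k); last by lia.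
by rewrite hz //; lia.
Qed.

Lemma injective_range_infinite (x : nat -> T) :
  injective x -> ~ finite_set (fun y => exists n, y = x n).
Proof.
move=> xI [l hl].
have nd n : NoDup (List.map x (List.seq 0 n)).
  by apply: FinFun.Injective_map_NoDup; [exact: xI|exact: seq_NoDup].
have /(NoDup_incl_length (nd (length l).+1)) : incl (List.map x (List.seq 0 (length l).+1)) l.
  by move=> y /in_map_iff[k [<- _]]; apply: hl; exists k.
rewrite length_map length_seq; lia.
Qed.
End Finite.

(** * Powers and type (a) *)

Section Semigroup.
Variables (S : Type) (op : S -> S -> S).
Hypothesis opA : associative op.
Local Infix "⋅" := op (at level 40, left associativity).

Lemma has_sub_type_a_of (T L : S -> Prop) :
    ~ finite_set T -> finite_set L ->
    (forall x y, T x -> T y -> L (x ⋅ y)) -> (forall x y, T x -> L y -> L (x ⋅ y)) ->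
    (forall x y, L x -> T y -> L (x ⋅ y)) -> (forall x y, L x -> L y -> L (x ⋅ y)) ->
  has_sub_type_a op.
Proof.
move=> Tinf Lfin TT TL LT LL.
have prodL x y : T x \/ L x -> T y \/ L y -> L (x ⋅ y).
  by move=> [hx|hx] [hy|hy]; auto.
exists (fun x => T x \/ L x); split; [|split].
- by move=> x y hx hy; right; apply: prodL.
- by move=> h; apply: Tinf; apply: finite_sub h => x; left.
- by apply: finite_sub Lfin => _ [x [y [hx [hy ->]]]]; apply: prodL.
Qed.

(** Exponents are meant to be positive, as there is no unit; [pow x 0] is the junk value [x]. *)
Definition pow (x : S) n := iter n.-1 (op x) x.

Lemma pow1 x : pow x 1 = x. Proof. by []. Qed.

Lemma powS x n : 0 < n -> pow x n.+1 = x ⋅ pow x n.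
Proof. by case: n. Qed.

Lemma powD x m n : 0 < m -> 0 < n -> pow x (m + n) = pow x m ⋅ pow x n.
Proof.
case: m => // m _ n0; elim: m => [|m IH]; first by rewrite add1n powS.
by rewrite addSn powS // IH (powS x (ltn0Sn m)) opA.
Qed.

Lemma powSr x n : 0 < n -> pow x n.+1 = pow x n ⋅ x.
Proof. by move=> n0; rewrite -addn1 powD. Qed.

(** A repetition makes the powers periodic from [i] on with period [j - i]; doubling an exponent
    that is at least [i] and a multiple of the period changes nothing. *)
Lemma idempotent_power x :
    ~ (forall m n, 0 < m -> 0 < n -> pow x m = pow x n -> m = n) ->
  exists k, 0 < k /\ pow x k ⋅ pow x k = pow x k.
Proof.
move=> h; have [i [j [i0 [ij e]]]] :
    exists i j, 0 < i /\ i < j /\ pow x i = pow x j.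
  apply: contrapT => hn; apply: h => m n m0 n0 e.
  by case: (ltngtP m n) => // lt; case: hn; [exists m, n|exists n, m].
have per k : i <= k -> pow x (k + (j - i)) = pow x k.
  move=> ik; case: (ltnP i k) => ik'.
    have -> : k + (j - i) = j + (k - i) by lia.
    rewrite powD -?e -?powD //; [congr pow|..]; lia.
  have -> : k = i by lia.
  by rewrite subnKC 1?ltnW.
have per' k m : i <= k -> pow x (k + m * (j - i)) = pow x k.
  move=> ik; elim: m => [|m IH]; first by rewrite addn0.
  by rewrite mulSn (addnC (j - i)) addnA per ?IH //; lia.
have ki : i <= i * (j - i) by rewrite leq_pmulr // subn_gt0.
exists (i * (j - i)); rewrite -powD; [|lia..].
by split; [lia|apply: per'].
Qed.

(** * Sequences whose pairwise products are a common zero *)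

Record orthogonal_seq (y : nat -> S) (z : S) : Prop := OrthogonalSeq {
  orthogonal_inj : injective y;
  orthogonal_mul : forall n m, n <> m -> y n ⋅ y m = z;
  orthogonal_mul0 : forall n, y n ⋅ z = z;
  orthogonal_0mul : forall n, z ⋅ y n = z;
  orthogonal_00 : z ⋅ z = z }.

Lemma orthogonal_subseq y z (s : nat -> nat) :
  injective s -> orthogonal_seq y z -> orthogonal_seq (y \o s) z.
Proof.
move=> sI [yI yy yz zy zz]; split=> //= [|n m nm]; first exact: inj_comp.
by apply: yy => /sI.
Qed.

Section OrthogonalSequence.
Variables (y : nat -> S) (z : S).
Hypothesis Oy : orthogonal_seq y z.
Let yI := orthogonal_inj Oy.
Let yy := orthogonal_mul Oy.
Let yz := orthogonal_mul0 Oy.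
Let zy := orthogonal_0mul Oy.
Let zz := orthogonal_00 Oy.

Lemma orthogonal_pow_l n a : 0 < a -> pow (y n) a ⋅ z = z.
Proof.
case: a => // a _; elim: a => [|a IH]; first exact: yz.
by rewrite powS // -opA IH yz.
Qed.

Lemma orthogonal_pow_r n a : 0 < a -> z ⋅ pow (y n) a = z.
Proof.
case: a => // a _; elim: a => [|a IH]; first exact: zy.
by rewrite powS // opA zy.
Qed.

Lemma orthogonal_pow n m a b :
  n <> m -> 0 < a -> 0 < b -> pow (y n) a ⋅ pow (y m) b = z.
Proof.
move=> nm; case: a => // a _; case: b => // b _.
have h : pow (y n) a.+1 ⋅ y m = z.
  elim: a => [|a IH]; first exact: yy.
  by rewrite powS // -opA IH yz.
elim: b => [|b IH]; first by rewrite pow1.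
by rewrite (powSr (y m) (ltn0Sn b)) opA IH zy.
Qed.

Lemma orthogonal_pow_eq n m a b : n <> m -> 0 < a -> 0 < b ->
  pow (y n) a = pow (y m) b -> pow (y n) a.+1 = z.
Proof.
by move=> nm a0 b0 e; rewrite powS // e -[y n]pow1 orthogonal_pow.
Qed.

(** No power of a term is [z], since the next power would be [z] too; and equal powers of two
    different terms would force a power to be [z]. *)
Lemma orthogonal_free_has_sub_C :
    (forall n a b, 0 < a -> 0 < b -> pow (y n) a = pow (y n) b -> a = b) ->
  has_sub_C op.
Proof.
move=> free.
have nz n a : 0 < a -> pow (y n) a <> z.
  move=> a0 e; have : pow (y n) a = pow (y n) a.+1 by rewrite powS // e yz.
  by move/(free _ _ _ a0 (ltn0Sn _)); lia.
exists (fun u => if u is Some (m, n) then pow (y m.-1) n else z); split.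
- move=> [[m n]|] [[m' n']|] //=.
  + move=> /andP[m0 n0] /andP[m'0 n'0] e.
    have [em|nm] := pselect (m.-1 = m'.-1).
      by move: e; rewrite em => /free -> //; congr (Some (_, _)); lia.
    by have := nz m.-1 n.+1 isT; rewrite (orthogonal_pow_eq nm _ _ e).
  + by move=> /andP[_ n0] _ /nz-/(_ n0).
  + by move=> _ /andP[_ n0] /esym/nz-/(_ n0).
- move=> [[m n]|] [[m' n']|] //=.
  + move=> /andP[m0 n0] /andP[m'0 n'0]; case: eqP => [->|mm']; first exact: powD.
    by rewrite orthogonal_pow //; lia.
  + by move=> /andP[_ n0] _; rewrite orthogonal_pow_l.
  + by move=> _ /andP[_ n0]; rewrite orthogonal_pow_r.
Qed.

Lemma orthogonal_idempotent_has_sub_fan (g : nat -> S) :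
    injective g -> (forall n, exists k, 0 < k /\ g n = pow (y n) k) ->
    (forall n, g n ⋅ g n = g n) ->
  has_sub_fan op.
Proof.
move=> gI gpow gg.
have gorth n m : n <> m -> g n ⋅ g m = z.
  by have [a [a0 ->]] := gpow n; have [b [b0 ->]] := gpow m; move=> nm; rewrite orthogonal_pow.
have gz n : g n ⋅ z = z by have [a [a0 ->]] := gpow n; rewrite orthogonal_pow_l.
have zg n : z ⋅ g n = z by have [a [a0 ->]] := gpow n; rewrite orthogonal_pow_r.
(* At most one term of the injective [g] is [z]; shifting past it leaves [z] free to play the bottom
   element 1 of the fan. *)
have [s sI gs] : exists2 s : nat -> nat, injective s & forall n, g (s n) <> z.
  have [[m gm]|h] := pselect (exists m, g m = z); last first.
    by exists id => // n e; apply: h; exists n.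
  exists (fun n => m + n.+1) => [i j|n]; first by lia.
  by rewrite -gm => /gI; lia.
exists (fun n => if n <= 1 then z else g (s n)); split.
- move=> m n m0 n0; case: (leqP m 1) => hm; case: (leqP n 1) => hn; first by lia.
  + by move=> /esym/gs.
  + by move/gs.
  + by move/gI/sI.
- move=> m n m0 n0; rewrite /fan_op; case: eqP => [->|mn].
    by case: ifP.
  rewrite leqnn; case: (leqP m 1) => hm; case: (leqP n 1) => hn //.
  by rewrite gorth // => /sI.
Qed.

Lemma orthogonal_square_has_sub_a w :
  (forall n, y n ⋅ y n = z \/ y n ⋅ y n = w) ->
  (forall n, y n ⋅ w = z) -> (forall n, w ⋅ y n = z) ->
  (w ⋅ w = z) -> w ⋅ z = z -> z ⋅ w = z -> has_sub_type_a op.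
Proof.
move=> y2 yw wy ww wz zw.
apply: (@has_sub_type_a_of (fun x => exists n, x = y n) (fun x => x = z \/ x = w)).
- exact: injective_range_infinite.
- by apply: finite_setU; apply: finite_set1.
- move=> _ _ [n ->] [m ->]; have [->//|nm] := pselect (n = m).
  by left; apply: yy.
- by move=> _ _ [n ->] [->|->]; left.
- by move=> _ _ [->|->] [n ->]; left.
- by move=> _ _ [->|->] [->|->]; left.
Qed.

End OrthogonalSequence.

(** Let [k n] be the least exponent at which the powers of [y n] reach [z]. The power with half that
    exponent, rounded up, has square [z]. Infinitely many such half powers form type (a) with [z];
    if they are constant along a subsequence, the terms themselves do, with [z] and the constant
    adjoined. *)
Lemma orthogonal_nil_has_sub_a y z :
    orthogonal_seq y z -> (forall n, exists k, 0 < k /\ pow (y n) k = z) ->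
  has_sub_type_a op.
Proof.
move=> Oy nil.
have /choice[k hk] : forall n, exists k, 0 < k /\ pow (y n) k = z /\
    forall j, 0 < j -> pow (y n) j = z -> k <= j.
  move=> n; have : exists k, (0 < k) && `[< pow (y n) k = z >].
    by have [k [k0 hk]] := nil n; exists k; rewrite k0; apply/asboolP.
  case/ex_minnP => k /andP[k0 /asboolP e] kmin; exists k; split=> //; split=> // j j0 hj.
  by apply: kmin; rewrite j0; apply/asboolP.
have pown n j : k n <= j -> pow (y n) j = z.
  have [k0 [e _]] := hk n; rewrite leq_eqVlt => /orP[/eqP<- //|kj].
  by rewrite -(subnKC (ltnW kj)) powD // ?subn_gt0 // e (orthogonal_pow_r Oy) ?subn_gt0.
pose c n := uphalf (k n).
have c0 n : 0 < c n by rewrite /c; have [] := hk n; case: (k n) => [|[]].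
have cc n : k n <= c n + c n by rewrite /c; lia.
(* w n squares to z; if w is constant, then y_n w = z forces k n <= 3. *)
pose w n := pow (y n) (c n).
have ww n : w n ⋅ w n = z by rewrite -powD // pown.
have [s [sI [wI|wc]]] := subseq_injective_or_constant w.
  apply: (@has_sub_type_a_of (fun x => exists n, x = w (s n)) (fun x => x = z)).
  - exact: (injective_range_infinite wI).
  - exact: finite_set1.
  - move=> _ _ [n ->] [m ->]; have [->//|nm] := pselect (n = m).
    by rewrite (orthogonal_pow Oy) // => /sI.
  - by move=> _ _ [n ->] ->; rewrite (orthogonal_pow_l Oy).
  - by move=> _ _ -> [n ->]; rewrite (orthogonal_pow_r Oy).
  - by move=> _ _ -> ->; exact: orthogonal_00 Oy.
have yw n : y (s n) ⋅ w (s 0) = z.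
  (* Constancy lets [w (s 0)] be read as a power of a term with another index. *)
  have [m nm] : exists m, n <> m by exists n.+1; lia.
  by rewrite -(wc m) -[y _]pow1 (orthogonal_pow Oy) // => /sI.
have wy n : w (s 0) ⋅ y (s n) = z.
  have [m nm] : exists m, m <> n by exists n.+1; lia.
  by rewrite -(wc m) -[y _]pow1 (orthogonal_pow Oy) // => /sI.
have y2 n : y (s n) ⋅ y (s n) = z \/ y (s n) ⋅ y (s n) = w (s 0).
  have : k (s n) <= (c (s n)).+1.
    have [_ [_ kmin]] := hk (s n); apply: kmin => //.
    by rewrite powS // -/(w _) wc yw.
  rewrite -(wc n) => kc.
  (* For exponent 1 the square is already [z]; for exponent 2 the half power is the square
     itself. *)
  have [e|e] : c (s n) = 1 \/ c (s n) = 2 by move: (c0 (s n)) kc; rewrite /c; lia.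
    by left; apply: (pown (s n) 2); rewrite /c in e; lia.
  by right; rewrite /w e.
apply: (orthogonal_square_has_sub_a (orthogonal_subseq sI Oy) y2 yw wy) => //.
- by rewrite /w (orthogonal_pow_l Oy).
- by rewrite /w (orthogonal_pow_r Oy).
Qed.

(** Along a subsequence either every term has distinct powers, which gives (c), or every term has an
    idempotent power. Infinitely many such idempotents give the fan; a constant one equals [z], so
    the terms are nilpotent and give (a). *)
Lemma orthogonal_has_sub y z : orthogonal_seq y z ->
  has_sub_type_a op \/ has_sub_fan op \/ has_sub_C op.
Proof.
move=> Oy.
pose free n := `[< forall a b, 0 < a -> 0 < b -> pow (y n) a = pow (y n) b -> a = b >].
have [s [sI [fI|fc]]] := subseq_injective_or_constant free.
  (* A Boolean sequence is not injective on three indices, so only the constant case survives. *)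
  have f01 : (free \o s) 0 <> (free \o s) 1 by move/fI.
  have f02 : (free \o s) 0 <> (free \o s) 2 by move/fI.
  have f12 : (free \o s) 1 <> (free \o s) 2 by move/fI.
  by move: f01 f02 f12; case: (_ 0); case: (_ 1); case: (_ 2).
have Os := orthogonal_subseq sI Oy.
case f0 : (free (s 0)) fc => fc.
  by right; right; apply: (orthogonal_free_has_sub_C Os) => n; apply/asboolP/fc.
have /choice[k hk] n : exists k, 0 < k /\ pow (y (s n)) k ⋅ pow (y (s n)) k = pow (y (s n)) k.
  by apply: idempotent_power; have /negbT/asboolPn := fc n.
pose g n := pow (y (s n)) (k n).
have [t [tI [gI|gc]]] := subseq_injective_or_constant g.
  right; left.
  apply: (orthogonal_idempotent_has_sub_fan (orthogonal_subseq tI Os) gI) => n /=.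
    by exists (k (t n)); case: (hk (t n)).
  by case: (hk (t n)).
left; apply: (orthogonal_nil_has_sub_a (orthogonal_subseq tI Os)) => n.
exists (k (t n)); split; first by case: (hk (t n)).
have [k0 <-] := hk (t n).
(* The constant idempotent is its own square, and the two factors can be read as powers of different
   terms. *)
have [m nm] : exists m, n <> m by exists n.+1; lia.
have := gc n; rewrite /= -(gc m) /g /= => {2}->.
apply: (orthogonal_pow Os) => //; first by move/tI.
by case: (hk (t m)).
Qed.

(** * Collapsing sequences *)

(* In the application z k is the k-th power of a nonprincipal ultrafilter, which
   is principal for k >= 2; z 0 and z 1 are junk. *)
Record collapsing_seq (x z : nat -> S) (r : S) : Prop := CollapsingSeq {
  collapsing_inj : injective x;
  collapsing_mul : forall n m, n <> m -> x n ⋅ x m = z 2 \/ x n ⋅ x m = r;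
  collapsing_mulz : forall n k, 2 <= k -> x n ⋅ z k = z k.+1;
  collapsing_zmul : forall n k, 2 <= k -> z k ⋅ x n = z k.+1;
  collapsing_mulr : forall n, x n ⋅ r = z 3;
  collapsing_rmul : forall n, r ⋅ x n = z 3;
  collapsing_zz : forall k l, 2 <= k -> 2 <= l -> z k ⋅ z l = z (k + l);
  collapsing_rr : r ⋅ r = z 4;
  collapsing_rz : forall k, 2 <= k -> r ⋅ z k = z k.+2;
  collapsing_zr : forall k, 2 <= k -> z k ⋅ r = z k.+2 }.

Lemma collapsing_subseq x z r (s : nat -> nat) :
  injective s -> collapsing_seq x z r -> collapsing_seq (x \o s) z r.
Proof.
move=> sI [xI xx xz zx xr rx zz rr rz zr].
by split=> /=; auto; exact: inj_comp.
Qed.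

Section CollapsingSequence.
Variables (x z : nat -> S) (r : S).
Hypothesis Cx : collapsing_seq x z r.

Lemma collapsing_pow_z n a k : 0 < a -> 2 <= k -> pow (x n) a ⋅ z k = z (a + k).
Proof.
case: a => // a _ k2; elim: a => [|a IH]; first exact: (collapsing_mulz Cx).
by rewrite powS // -opA IH (collapsing_mulz Cx) //; lia.
Qed.

Lemma collapsing_z_pow n a k : 0 < a -> 2 <= k -> z k ⋅ pow (x n) a = z (k + a).
Proof.
case: a => // a _ k2; elim: a => [|a IH].
  by rewrite addn1 (collapsing_zmul Cx).
by rewrite (powSr (x n) (ltn0Sn a)) opA IH (collapsing_zmul Cx) ?addnS //; lia.
Qed.

Lemma collapsing_pow_r n a : 0 < a -> pow (x n) a ⋅ r = z a.+2.
Proof.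
case: a => // a _; elim: a => [|a IH]; first exact: (collapsing_mulr Cx).
by rewrite powS // -opA IH (collapsing_mulz Cx).
Qed.

Lemma collapsing_r_pow n a : 0 < a -> r ⋅ pow (x n) a = z a.+2.
Proof.
case: a => // a _; elim: a => [|a IH]; first exact: (collapsing_rmul Cx).
by rewrite (powSr (x n) (ltn0Sn a)) opA IH (collapsing_zmul Cx).
Qed.

(** [z 2] and [r] both multiply as elements of degree 2, so the choice between them is forgotten
    once a third factor is present; hence the bound [2 < a + b]. *)
Lemma collapsing_pow n m a b : n <> m -> 0 < a -> 0 < b -> 2 < a + b ->
  pow (x n) a ⋅ pow (x m) b = z (a + b).
Proof.
move=> nm a0 b0 ab.
have h c : 1 < c -> pow (x n) c ⋅ x m = z c.+1.
  case: c => [|[|c]] // _; rewrite (powSr (x n) (ltn0Sn c)) -opA.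
  have [->|->] := collapsing_mul Cx nm; last by rewrite collapsing_pow_r.
  by rewrite collapsing_pow_z // addn2.
case: b b0 ab => [|[|b]] // _ ab; first by rewrite h ?addn1 //; lia.
rewrite powS // opA; case: (ltnP 1 a) => a1.
  by rewrite h // collapsing_z_pow //; congr z; lia.
have -> : a = 1 by lia.
have [/= ->|/= ->] := collapsing_mul Cx nm; last by rewrite collapsing_r_pow.
by rewrite collapsing_z_pow.
Qed.

(** The [j]-th powers are infinitely many, and their products fall into the finite set of [r], the
    [z k] and the higher powers, since degrees add. *)
Lemma collapsing_finite_pow_has_sub_a j :
    0 < j -> ~ finite_set (fun u => exists n, u = pow (x n) j) ->
    finite_set (fun u => exists k, u = z k) ->
    finite_set (fun u => exists n k, j < k /\ u = pow (x n) k) ->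
  has_sub_type_a op.
Proof.
move=> j0 inf zfin powfin.
pose Z u := exists k, 2 <= k /\ u = z k.
pose L u := u = r \/ Z u \/ exists n k, j < k /\ u = pow (x n) k.
have LZ k : 2 <= k -> L (z k) by move=> k2; right; left; exists k.
have Lpow n m a b : 0 < a -> 0 < b -> j < a + b -> L (pow (x n) a ⋅ pow (x m) b).
  move=> a0 b0 ab; have [->|nm] := pselect (n = m).
    by rewrite -powD //; right; right; exists m, (a + b).
  case: (ltnP 2 (a + b)) => ab2.
    by rewrite collapsing_pow //; apply: LZ; lia.
  have [-> ->] : a = 1 /\ b = 1 by lia.
  by have [/= ->|/= ->] := collapsing_mul Cx nm; [apply: LZ|left].
apply: (has_sub_type_a_of (L := L) inf).
- apply: finite_setU; first exact: finite_set1.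
  by apply: finite_setU => //; apply: finite_sub zfin => u [k [_ ->]]; exists k.
- by move=> _ _ [n ->] [m ->]; apply: Lpow => //; lia.
- move=> _ _ [n ->] [->|[[k [k2 ->]]|[m [k [jk ->]]]]].
  + by rewrite collapsing_pow_r //; apply: LZ.
  + by rewrite collapsing_pow_z //; apply: LZ; lia.
  + by apply: Lpow; lia.
- move=> _ _ [->|[[k [k2 ->]]|[m [k [jk ->]]]]] [n ->].
  + by rewrite collapsing_r_pow //; apply: LZ.
  + by rewrite collapsing_z_pow //; apply: LZ; lia.
  + by apply: Lpow; lia.
- have [_ _ _ _ _ _ zz rr rz zr] := Cx.
  move=> _ _ [->|[[k [k2 ->]]|[m [k [jk ->]]]]] [->|[[l [l2 ->]]|[m' [l [jl ->]]]]].
  + by rewrite rr; apply: LZ.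
  + by rewrite rz //; apply: LZ; lia.
  + by rewrite collapsing_r_pow; [apply: LZ|..]; lia.
  + by rewrite zr //; apply: LZ; lia.
  + by rewrite zz //; apply: LZ; lia.
  + by rewrite collapsing_z_pow; [apply: LZ|..]; lia.
  + by rewrite collapsing_pow_r; [apply: LZ|..]; lia.
  + by rewrite collapsing_pow_z; [apply: LZ|..]; lia.
  + by apply: Lpow; lia.
Qed.
End CollapsingSequence.

(** [N] is a multiple of the period, so [z N] is idempotent and infinitely many [N]-th powers form
    an orthogonal sequence with zero [z N]. Otherwise the largest exponent with infinitely many
    powers leads to type (a). *)
Lemma collapsing_has_sub x z r i j :
    collapsing_seq x z r -> 2 <= i < j -> (forall k, i <= k -> z (k + (j - i)) = z k) ->
  has_sub_type_a op \/ has_sub_fan op \/ has_sub_C op.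
Proof.
move=> Cx /andP[i2 ij] per.
have per' k m : i <= k -> z (k + m * (j - i)) = z k.
  move=> ik; elim: m => [|m IH]; first by rewrite addn0.
  by rewrite mulSn (addnC (j - i)) addnA per ?IH //; lia.
pose N := i * (j - i).
have iN : i <= N by rewrite /N leq_pmulr // subn_gt0.
have zN : z (N + N) = z N by apply: per'.
have [s [sI [pI|pc]]] := subseq_injective_or_constant (fun n => pow (x n) N).
  have Cs := collapsing_subseq sI Cx.
  apply: (@orthogonal_has_sub (fun n => pow (x (s n)) N) (z N)); split=> //.
  - by move=> n m nm; rewrite (collapsing_pow Cs) //; lia.
  - by move=> n; rewrite (collapsing_pow_z Cs) //; lia.
  - by move=> n; rewrite (collapsing_z_pow Cs) //; lia.
  - by rewrite (collapsing_zz Cx) //; lia.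
left; have Cs := collapsing_subseq sI Cx.
have zfin := periodic_range_finite ij per.
have powz n k : N < k -> pow (x (s n)) k = z k.
  move=> Nk; have [m nm] : exists m, n <> m by exists n.+1; lia.
  have -> : k = N + (k - N) by lia.
  rewrite powD; [|lia..]; rewrite (pc n) -(pc m).
  by rewrite (collapsing_pow Cs) //; [move/esym|lia..].
pose inf k := `[< ~ finite_set (fun u => exists n, u = pow (x (s n)) k) >].
have inf1 : (0 < 1) && inf 1.
  by apply/asboolP/injective_range_infinite/inj_comp => //; exact: (collapsing_inj Cx).
have infN k : (0 < k) && inf k -> k <= N.
  move=> /andP[k0 /asboolP infk]; rewrite leqNgt; apply/negP => Nk; apply: infk.
  by apply: finite_sub (finite_set1 (z k)) => u [n ->]; apply: powz.
(* Exponent 1 has infinitely many powers because [x] is injective; no exponent above [N] does. *)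
have [m /andP[m0 /asboolP minf] mmax] :=
  ex_maxnP (ex_intro (fun k => (0 < k) && inf k) 1 inf1) infN.
apply: (collapsing_finite_pow_has_sub_a Cs m0 minf zfin).
have fin k : m < k -> finite_set (fun u => exists n, u = pow (x (s n)) k).
  move=> mk; apply: contrapT => h.
  have : k <= m by apply: mmax; rewrite (leq_ltn_trans _ mk) //; apply/asboolP.
  by lia.
apply: (finite_sub _ (finite_setU zfin (finite_bigcup (n := N.+1)
  (A := fun k u => m < k /\ exists n, u = pow (x (s n)) k) _))).
- move=> u [n [k [mk ->]]]; case: (ltnP N k) => Nk.
    by left; exists k; apply: powz.
  by right; exists k; split=> //; split=> //; exists n.
- move=> k _; case: (ltnP m k) => mk.
    by apply: finite_sub (fin _ mk) => u [].
  by exists [::] => u [].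
Qed.

(** * Sums over blocks and sumsequences *)

Section Blocks.
Variable a : nat -> S.
Implicit Types F G : blk.

Lemma blk_sum_cons i j s : blk_sum op a (i, j :: s) = a i ⋅ blk_sum op a (j, s).
Proof.
rewrite /blk_sum /=; elim: s (a j) => //= k s IH u.
by rewrite -opA IH.
Qed.

Lemma blk_sum_rcons i s j :
  blk_sum op a (i, rcons s j) = blk_sum op a (i, s) ⋅ a j.
Proof. by rewrite /blk_sum /= foldl_rcons. Qed.

Definition blk_cat F G : blk := (F.1, F.2 ++ G.1 :: G.2).

Lemma blk_sum_cat F G :
  blk_sum op a (blk_cat F G) = blk_sum op a F ⋅ blk_sum op a G.
Proof.
case: F => i s; case: G => j t; rewrite /blk_cat /=; elim: s i => [|k s IH] i /=.
  by rewrite blk_sum_cons.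
by rewrite !blk_sum_cons IH opA.
Qed.

Lemma valid_blk_cat F G :
  valid_blk F -> valid_blk G -> blk_lt F G -> valid_blk (blk_cat F G).
Proof. by rewrite /valid_blk /blk_lt /= cat_path /= => -> -> ->. Qed.

Lemma blk_max_ge F : valid_blk F -> F.1 <= blk_max F.
Proof.
case: F => i s; rewrite /valid_blk /blk_max /=; elim: s i => //= j s IH i.
by move=> /andP[ij /IH]; lia.
Qed.

Lemma sumseq_blocks_lt (F : nat -> blk) i j :
  sumseq_blocks F -> i < j -> blk_lt (F i) (F j).
Proof.
move=> [Fv Fl]; elim: j => // j IH; rewrite ltnS leq_eqVlt => /orP[/eqP->//|/IH].
by have := blk_max_ge (Fv j); have := Fl j; rewrite /blk_lt; lia.
Qed.
End Blocks.

(** The tails FS(a_n, a_{n+1}, ...) that the ultrafilters will be required to contain. *)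
Definition FS_from (a : nat -> S) n : S -> Prop :=
  fun x => exists F, [/\ valid_blk F, n <= F.1 & x = blk_sum op a F].

Lemma FS_from_mul a n x F : FS_from a (blk_max F).+1 x -> valid_blk F -> n <= F.1 ->
  FS_from a n (blk_sum op a F ⋅ x).
Proof.
move=> [G [Gv FG ->]] Fv nF; exists (blk_cat F G).
by split; rewrite ?blk_sum_cat //; apply: valid_blk_cat.
Qed.

Lemma FS_sumseq a (F : nat -> blk) x :
  sumseq_blocks F -> FS op (sumseq op a F) x -> FS op a x.
Proof.
move=> Fb [[i s] [Hv ->]].
(* Keeping track of the starting index is what makes concatenation with an earlier block valid. *)
suff [G [Gv _ ->]] : FS_from a (F i).1 (blk_sum op (sumseq op a F) (i, s)) by exists G.
elim: s i Hv => [|j s IH] i /=.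
  by move=> _; exists (F i); split=> //; apply: Fb.1.
rewrite {1}/valid_blk /= => /andP[ij Hv]; rewrite blk_sum_cons.
apply: FS_from_mul => //; last exact: Fb.1.
have [G [Gv jG ->]] := IH j Hv; exists G; split=> //.
by apply: leq_trans jG; exact: (sumseq_blocks_lt Fb ij).
Qed.

Lemma proper_seq_injective b : proper_seq op b -> injective b.
Proof. by move=> bp; apply: injective_lt => i j ij; exact: (bp (i, [::]) (j, [::])). Qed.

(** * The obstruction given by the three types *)

(** With [L] finite, a common consequence of the three types that defeats both proper sumsequences
    and partition regularity. *)
Definition almost_null (a : nat -> S) (L : S -> Prop) :=
  forall x y, FS op a x -> FS op a y -> ~ L x -> ~ L y -> x <> y -> L (x ⋅ y).

(** One of [b (2 * k)], [b (2 * k).+1] and their sum lies in [L]. For different [k] properness makes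
    these elements distinct, so [L] would be infinite. *)
Lemma almost_null_no_proper_sumseq a L : finite_set L -> almost_null a L ->
  ~ exists F, sumseq_blocks F /\ proper_seq op (sumseq op a F).
Proof.
move=> Lfin aL [F [Fb bp]]; set b := sumseq op a F in bp.
have bFS n : FS op a (b n) by apply: (FS_sumseq Fb); exists (n, [::]).
have bI := proper_seq_injective bp.
have /choice[G hG] k : exists G, [/\ valid_blk G, 2 * k <= G.1,
    blk_max G < 2 * k.+1 & L (blk_sum op b G)].
  have [h0|h0] := pselect (L (b (2 * k))).
    by exists (2 * k, [::]); split=> //; rewrite /blk_max /=; lia.
  have [h1|h1] := pselect (L (b (2 * k).+1)).
    by exists ((2 * k).+1, [::]); split=> //; rewrite /blk_max /=; lia.
  exists (2 * k, [:: (2 * k).+1]).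
  split; [by rewrite /valid_blk /= ltnSn|by []|by rewrite /blk_max /=; lia|].
  by apply: (aL _ _ (bFS _) (bFS _) h0 h1) => /bI; lia.
apply: (@injective_range_infinite _ (fun k => blk_sum op b (G k))).
  apply: injective_lt => i j ij; have [vi _ hi _] := hG i; have [vj hj _ _] := hG j.
  by apply: bp => //; rewrite /blk_lt; lia.
by apply: finite_sub Lfin => x [n ->]; have [] := hG n.
Qed.

(** Each element of [L] is alone in its colour. Hence [b 0] and [b 1] lie outside [L], while their
    sum lies in [L] and has the same colour as they do. *)
Lemma almost_null_not_partition_regular a L :
    injective a -> finite_set L -> almost_null a L ->
  ~ forall A : S -> Prop, proper_IP_set op A -> forall (C : finType) (c : S -> C),
      exists i : C, proper_IP_set op (fun x => A x /\ c x = i).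
Proof.
move=> aI [l hl] aL PR.
(* The colour is the first position in [l]; all elements outside [l] share the colour [size l]. *)
pose c (x : S) : 'I_(size l).+1 := inord (index (x : {classic S}) (l : seq {classic S})).
have [i [b [bI hb]]] := PR _ (ex_intro _ a (conj aI (fun x h => h))) _ c.
have cval x : nat_of_ord (c x) = index (x : {classic S}) (l : seq {classic S}).
  by rewrite /c inordK // ltnS index_size.
have inl x : L x -> (x : {classic S}) \in (l : seq {classic S}).
  by move=> /hl; elim: (l) => //= y s IH [->|/IH]; rewrite inE ?eqxx // => ->; rewrite orbT.
have cL x y : L x -> c x = c y -> x = y.
  move=> /inl Lx /(congr1 val); rewrite /= !cval => e.
  have Ly : (y : {classic S}) \in (l : seq {classic S}) by rewrite -index_mem -e index_mem.
  by rewrite -[LHS](nth_index (x : {classic S}) Lx) e nth_index.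
have [F0 c0] : FS op a (b 0) /\ c (b 0) = i by apply: hb; exists (0, [::]).
have [F1 c1] : FS op a (b 1) /\ c (b 1) = i by apply: hb; exists (1, [::]).
have [F2 c2] : FS op a (b 2) /\ c (b 2) = i by apply: hb; exists (2, [::]).
have [_ c01] : FS op a (b 0 ⋅ b 1) /\ c (b 0 ⋅ b 1) = i by apply: hb; exists (0, [:: 1]).
have L0 : ~ L (b 0) by move=> /cL/(_ (etrans c0 (esym c1)))/bI.
have L1 : ~ L (b 1) by move=> /cL/(_ (etrans c1 (esym c0)))/bI.
have L01 : L (b 0 ⋅ b 1) by apply: aL => // /bI.
by apply: L0; rewrite -(cL _ _ L01 (etrans c01 (esym c0))).
Qed.

Lemma FS_sub a (A : S -> Prop) x :
  (forall n, A (a n)) -> (forall u v, A u -> A v -> A (u ⋅ v)) -> FS op a x -> A x.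
Proof.
move=> aA AA [[i s] [_ ->]]; elim: s i => [|j s IH] i; first exact: aA.
by rewrite blk_sum_cons; apply: AA.
Qed.

Lemma constant_mul_almost_null (a : nat -> S) z :
    (forall m n, m <> n -> a m ⋅ a n = z) -> (forall n, a n ⋅ z = z) ->
  almost_null a (fun x => x = z).
Proof.
move=> aa az.
have FSa i s : valid_blk (i, s) ->
    blk_sum op a (i, s) = a i \/ blk_sum op a (i, s) = z.
  elim: s i => [|j s IH] i; first by left.
  rewrite blk_sum_cons {1}/valid_blk /= => /andP[ij /IH[->|->]]; right=> //.
  by apply: aa; lia.
move=> _ _ [[i s] [Fv ->]] [[j t] [Gv ->]].
have [->|->] := FSa i s Fv; have [->|->] := FSa j t Gv => // _ _ ne.
by apply: aa => ij; apply: ne; rewrite ij.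
Qed.

Lemma has_sub_almost_null :
    has_sub_type_a op \/ has_sub_fan op \/ has_sub_C op ->
  exists a L, [/\ injective a, finite_set L & almost_null a L].
Proof.
move=> [[A [AA [Ainf TTfin]]]|[[f [fI fM]]|[f [fI fM]]]].
- have /(@chain_exists S A (fun x y => x <> y))[a [aA aI]] : forall l : list S,
      (forall y, In y l -> A y) -> exists x, A x /\ forall y, In y l -> y <> x.
    move=> l _; apply: contrapT => /forallNP h; apply: Ainf; exists l => x Ax.
    by apply: contrapT => nx; apply: (h x); split=> // y hy e; apply: nx; rewrite -e.
  exists a, (fun z => exists x y, A x /\ A y /\ z = x ⋅ y); split=> //.
    exact: injective_lt.
  by move=> x y /(FS_sub aA AA) Ax /(FS_sub aA AA) Ay _ _ _; exists x, y.
(* Starting at 2 leaves out the bottom element 1, the common product. *)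
- exists (fun n => f n.+2), (fun x => x = f 1); split.
  + by move=> m n /fI e; have := e isT isT; lia.
  + exact: finite_set1.
  + by apply: constant_mul_almost_null => [m n mn|n]; rewrite -fM // /fan_op;
      case: eqP => //; lia.
- exists (fun n => f (Some (n.+1, 1))), (fun x => x = f None); split.
  + by move=> m n /fI e; have := e isT isT; case.
  + exact: finite_set1.
  + by apply: constant_mul_almost_null => [m n mn|n]; rewrite -fM //=;
      case: eqP => //; lia.
Qed.

(** * Ultrafilters, their product and their topology *)

Local Open Scope classical_set_scope.

Definition principal (x : S) : set_system S := [set A | A x].

Definition free (p : set_system S) :=
  UltraFilter p /\ forall x, p (~` [set x]).

(** The limit along [q] in [s] of the limit along [p] in [t] of [s ⋅ t]. With this order,
    multiplication by a fixed [p] on the right is continuous. *)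
Definition umul (q p : set_system S) : set_system S :=
  [set X | q [set s | p [set t | X (s ⋅ t)]]].
Local Infix "⊙" := umul (at level 40, left associativity).

Lemma ultra_of_dichotomy (F : set_system S) :
  ProperFilter F -> (forall A, F A \/ F (~` A)) -> UltraFilter F.
Proof.
move=> FF dich; split=> // G GF FG; apply/seteqP; split=> // A GA.
have [//|/FG GnA] := dich A; case: (filter_not_empty G).
by rewrite -(classical_sets.setICr A); apply: filterI.
Qed.

Lemma ultra_sub_eq (p q : set_system S) :
  UltraFilter p -> UltraFilter q -> p `<=` q -> p = q.
Proof. by move=> pU qU pq; apply/esym/max_filter. Qed.

Lemma ultraC (p : set_system S) A : UltraFilter p -> ~ p A -> p (~` A).
Proof. by move=> pU nA; have [] := in_ultra_setVsetC A pU. Qed.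

Lemma ultra_disjoint (p : set_system S) A : UltraFilter p -> p A -> p (~` A) -> False.
Proof.
move=> pU pA pnA; apply: (filter_not_empty p).
by rewrite -(classical_sets.setICr A); apply: filterI.
Qed.

Lemma principal_ultra x : UltraFilter (principal x).
Proof.
apply: ultra_of_dichotomy => [|A]; last by have [] := pselect (A x); [left|right].
split=> //; split=> //= P Q PQ; exact: PQ.
Qed.

Lemma principalP (p : set_system S) x : UltraFilter p -> p [set x] -> p = principal x.
Proof.
move=> pU px; apply/esym/ultra_sub_eq => //; first exact: principal_ultra.
by move=> A Ax; apply: filterS px => _ ->.
Qed.

Lemma not_free_principal p : UltraFilter p -> ~ free p -> exists x, p = principal x.
Proof.
move=> pU nf; apply: contrapT => /forallNP h; apply: nf; split=> // x.
by apply: ultraC => // /principalP; exact: h.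
Qed.

Lemma free_not_principal p x : free p -> p <> principal x.
Proof. by move=> [_ /(_ x) + e]; rewrite e => /(_ erefl). Qed.

Lemma principal_inj : injective principal.
Proof. by move=> x y e; have : principal x [set y] by rewrite e. Qed.

Lemma free_infinite p A : free p -> p A -> ~ finite_set A.
Proof.
move=> [pU pf] + [l]; elim: l A => [|x l IH] A pA hA.
  by have [x /hA] := filter_ex pA.
apply: (IH (A `&` ~` [set x])) => [|y [/hA[->|//] /(_ erefl)//]].
by apply: filterI.
Qed.

Lemma umul_ultra q p : UltraFilter q -> UltraFilter p -> UltraFilter (q ⊙ p).
Proof.
move=> qU pU; apply: ultra_of_dichotomy.
  split; rewrite /umul /=.
    by move=> h; have [s /filter_ex[t]] := @filter_ex _ q _ _ h.
  split=> /=.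
  - by apply: filterE => s; apply: filterE.
  - move=> A B qA qB; apply: filterS (@filterI _ q _ _ _ qA qB) => s [As Bs].
    by apply: filterS (@filterI _ p _ _ _ As Bs).
  - by move=> A B AB; apply: filterS => s; apply: filterS => t; apply: AB.
move=> A; rewrite /umul /=.
have [h|h] := in_ultra_setVsetC [set s | p [set t | A (s ⋅ t)]] qU; first by left.
right; apply: filterS h => s; exact: ultraC.
Qed.

Lemma umulA q p r : q ⊙ (p ⊙ r) = q ⊙ p ⊙ r.
Proof.
apply/funext => X; rewrite /umul /=; congr q; apply/funext => s /=.
congr p; apply/funext => t /=; congr r; apply/funext => u /=.
by rewrite opA.
Qed.

Lemma umul_principal x y : principal x ⊙ principal y = principal (x ⋅ y).
Proof. by []. Qed.

(* The topology of the space of ultrafilters, whose basic clopen sets are the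
   sets of the r such that r X. *)
Definition adherent (D : set (set_system S)) (q : set_system S) :=
  forall X, (forall r, D r -> r X) -> q X.

Definition uclosed (D : set (set_system S)) :=
  D `<=` UltraFilter (T := S) /\ forall q, UltraFilter q -> adherent D q -> D q.

Lemma uclosed_ultra : uclosed (UltraFilter (T := S)).
Proof. by split. Qed.

Lemma uclosed_free : uclosed free.
Proof. by split=> [p []//|q qU h]; split=> // x; apply: h => r []. Qed.

Lemma uclosedI D E : uclosed D -> uclosed E -> uclosed (D `&` E).
Proof.
move=> [DU Dc] [EU Ec]; split=> [p [/DU]//|q qU h]; split.
  by apply: Dc => // X hX; apply: h => r [/hX].
by apply: Ec => // X hX; apply: h => r [_ /hX].
Qed.

(** A continuous image of a compact set: for [y] adherent to the image, an ultrafilter refining [G]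
    lies in [D] and is sent to [y]. *)
Lemma uclosed_mulr D p : uclosed D -> UltraFilter p -> uclosed [set q ⊙ p | q in D].
Proof.
move=> [DU Dc] pU; split=> [_ [q /DU qU <-]|y yU yad]; first exact: umul_ultra.
pose G := [set Z | exists A X, [/\ forall r, D r -> r A, y X &
  A `&` [set s | p [set t | X (s ⋅ t)]] `<=` Z]].
have GF : ProperFilter G.
  split; last split.
  (* If such an intersection were empty, every [r ⊙ p] with [r] in [D] would contain the complement
     of [X], and so would [y]. *)
  - move=> [A [X [hA yX AX]]]; apply: (@ultra_disjoint y X) => //.
    apply: yad => _ [r Dr <-]; have rU := DU _ Dr; have pr := umul_ultra rU pU.
    apply: ultraC => // h; apply: (filter_not_empty r).
    by apply: filterS (filterI (hA _ Dr) h).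
  - exists setT, setT; split=> // [r Dr|]; last exact: filterT.
    by have rU := DU _ Dr; apply: filterT.
  - move=> Z Z' [A [X [hA yX AX]]] [A' [X' [hA' yX' AX']]].
    exists (A `&` A'), (X `&` X'); split.
    + by move=> r Dr; have rU := DU _ Dr; apply: filterI; [apply: hA|apply: hA'].
    + exact: filterI.
    + move=> s [[As A's] h]; split; [apply: AX|apply: AX']; split=> //=.
        by apply: filterS h => t [].
      by apply: filterS h => t [].
  - move=> Z Z' ZZ' [A [X [hA yX AX]]]; exists A, X; split=> //.
    exact: subset_trans ZZ'.
have [r [rU Gr]] := ultraFilterLemma GF.
exists r; last first.
  apply/esym/ultra_sub_eq => //; first exact: umul_ultra.
  move=> X yX; apply: Gr; exists setT, X; split=> // q Dq.
  by have qU := DU _ Dq; apply: filterT.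
apply: Dc => // A hA; apply: Gr; exists A, setT; split=> //.
exact: filterT.
Qed.

Lemma uclosed_stabilizer D p : uclosed D -> UltraFilter p ->
  uclosed [set q | D q /\ q ⊙ p = p].
Proof.
move=> [DU Dc] pU; split=> [q [/DU]//|q qU h]; split.
  by apply: Dc => // X hX; apply: h => r [/hX].
apply/esym/ultra_sub_eq => //; first exact: umul_ultra.
by move=> X pX; apply: h => r [_ e]; rewrite -e in pX.
Qed.

Lemma free_tail_exists (x : nat -> S) : injective x ->
  exists p, free p /\ forall n, p [set s | exists k, n <= k /\ s = x k].
Proof.
move=> xI; pose G := [set X : set S | exists n, forall k, n <= k -> X (x k)].
have GF : ProperFilter G.
  split; first by move=> [n /(_ n (leqnn n))].
  split=> [|X Y [n hn] [m hm]|X Y XY [n hn]].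
  - by exists 0.
  - by exists (maxn n m) => k; rewrite geq_max => /andP[nk mk]; split; auto.
  - by exists n => k /hn/XY.
have [p [pU Gp]] := ultraFilterLemma GF.
exists p; split; last by move=> n; apply: Gp; exists n => k nk; exists k.
split=> // s; apply: Gp; have [[m ms]|h] := pselect (exists m, x m = s).
  by exists m.+1 => k mk e; move: e; rewrite -ms => /xI; lia.
by exists 0 => k _ e; apply: h; exists k.
Qed.

(** If [z] were injective, a free ultrafilter on its range would be adherent to the principal ones
    at its terms, hence in [D]. *)
Lemma uclosed_not_free_repeats D (z : nat -> S) : uclosed D ->
    (forall p, D p -> ~ free p) -> (forall n, D (principal (z n))) ->
  exists i j, i < j /\ z i = z j.
Proof.
move=> [DU Dc] nf Dz; apply: contrapT => h.
have /free_tail_exists[p [pf ptail]] : injective z.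
  by apply: injective_lt => i j ij e; apply: h; exists i, j.
apply: (nf p) => //; have pU := pf.1; apply: Dc => // X hX.
by apply: filterS (ptail 0) => _ [k [_ ->]]; apply: (hX _ (Dz k)).
Qed.

(** * Minimal closed subsemigroups and idempotents *)

Definition usemigroup (D : set (set_system S)) :=
  uclosed D /\ forall q p, D q -> D p -> D (q ⊙ p).

(** Zorn's lemma for reverse inclusion; compactness gives the intersection of a chain a point in
    [N]. The set [N] will be that of all ultrafilters or of the free ones. *)
Lemma minimal_usemigroup (N A : set (set_system S)) :
    uclosed N -> usemigroup A -> A `&` N !=set0 ->
  exists M, [/\ usemigroup M, M `<=` A, M `&` N !=set0 &
    forall M', usemigroup M' -> M' `<=` M -> M' `&` N !=set0 -> M `<=` M'].
Proof.
move=> Nc Asg AN.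
pose P D := [/\ usemigroup D, D `<=` A & D `&` N !=set0].
pose R (D E : {D : set (set_system S) | P D}) := `[< sval E `<=` sval D >].
have PA : P A by split.
have [||K Ktot|[M PM] Mmax] := @ZL_preorder _ (exist P A PA) R.
- by move=> D; apply/asboolP.
- by move=> D E F /asboolP DE /asboolP EF; apply/asboolP; apply: subset_trans DE.
- have [[D0 KD0]|K0] := pselect (K !=set0); last first.
    by exists (exist P A PA) => D KD; case: K0; exists D.
  (* An ultrafilter refining [G] is adherent to the trace on [N] of every member of the chain. *)
  pose G := [set X : set S | exists2 D, K D & forall r, (sval D `&` N) r -> r X].
  have GF : ProperFilter G.
    split; last split.
    + move=> [[D PD] KD /= h]; have [_ _ [r rDN]] := PD.
      have rU : UltraFilter r by apply: Nc.1; exact: rDN.2.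
      exact: filter_not_empty (h r rDN).
    + by exists D0 => // r [_ /(Nc.1) rU]; apply: filterT.
    + move=> X Y [D KD hX] [E KE hY].
      have [/asboolP ED|/asboolP DE] := Ktot _ _ KD KE.
        exists E => // r [Er Nr]; have rU := Nc.1 _ Nr; apply: filterI.
          by apply: hX; split=> //; apply: ED.
        by apply: hY.
      exists D => // r [Dr Nr]; have rU := Nc.1 _ Nr; apply: filterI.
        by apply: hX.
      by apply: hY; split=> //; apply: DE.
    + move=> X Y XY [D KD hX]; exists D => // r rDN.
      by have rU := Nc.1 _ rDN.2; apply: filterS XY _; apply: hX.
  have [q [qU Gq]] := ultraFilterLemma GF.
  have qK D : K D -> (sval D `&` N) q.
    move=> KD; have [[Dc _] _ _] := svalP D.
    by apply: (uclosedI Dc Nc).2 => // X hX; apply: Gq; exists D.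
  pose I := [set r | forall D, K D -> sval D r].
  have PI : P I.
    split; [split; [split|]|..].
    + by move=> r /(_ D0 KD0); have [[[DU _] _] _ _] := svalP D0; exact: DU.
    + move=> r rU h D KD; have [[[_ Dc] _] _ _] := svalP D; apply: Dc => // X hX.
      by apply: h => r' /(_ D KD); exact: hX.
    + move=> r r' Ir Ir' D KD; have [[_ Dm] _ _] := svalP D.
      by apply: Dm; [apply: Ir|apply: Ir'].
    + by move=> r /(_ D0 KD0); have [_ DA _] := svalP D0; exact: DA.
    + by exists q; split=> [D /qK[]//|]; case: (qK _ KD0).
  by exists (exist P I PI) => D KD; apply/asboolP => r /= /(_ D KD).
- have [Msg MA MN] := PM; exists M; split=> // M' M'sg M'M M'N.
  have PM' : P M' by split=> //; exact: subset_trans MA.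
  by have /asboolP := Mmax (exist P M' PM') (asboolT M'M).
Qed.

Lemma usemigroup_mulr D p : usemigroup D -> D p ->
  usemigroup [set q ⊙ p | q in D] /\ [set q ⊙ p | q in D] `<=` D.
Proof.
move=> [Dc Dm] Dp; split; last by move=> _ [q Dq <-]; apply: Dm.
split; first by apply: uclosed_mulr => //; exact: Dc.1.
move=> _ _ [q Dq <-] [r Dr <-]; exists (q ⊙ p ⊙ r); last by rewrite umulA.
exact: (Dm _ _ (Dm _ _ Dq Dp) Dr).
Qed.

Lemma usemigroup_stabilizer D p : usemigroup D -> UltraFilter p ->
  usemigroup [set q | D q /\ q ⊙ p = p].
Proof.
move=> [Dc Dm] pU; split; first exact: uclosed_stabilizer.
by move=> q r [Dq qp] [Dr rp]; split; [apply: Dm|rewrite -umulA rp].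
Qed.

(** The Ellis-Numakura argument: by minimality [M ⊙ p] is all of [M], so the stabilizer of [p] is
    nonempty, hence also all of [M], and contains [p]. *)
Lemma usemigroup_idempotent D : usemigroup D -> D !=set0 ->
  exists2 f, D f & f ⊙ f = f.
Proof.
move=> Dsg [p0 Dp0].
have [|M [Msg MD [p [Mp pU]] Mmin]] := minimal_usemigroup uclosed_ultra Dsg.
  by exists p0; split=> //; exact: Dsg.1.1.
have [Rsg RM] := usemigroup_mulr Msg Mp.
have [x Mx xp] : [set q ⊙ p | q in M] p.
  apply: Mmin => //; exists (p ⊙ p); split; first by exists p.
  exact: umul_ultra.
have [_ pp] : [set q | M q /\ q ⊙ p = p] p.
  apply: (Mmin _ (usemigroup_stabilizer Msg pU)) => //; first by move=> q [].
  by exists x; split=> //; exact: Msg.1.1.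
by exists p => //; exact: MD.
Qed.

(** With [f] as identity, [u] is a left inverse of [t] and lowers exponents by one. Cancelling in
    the repeated power gives [f = pow t d], so [u] is a power of [t]. *)
Lemma left_inverse_power f t u i j : u ⋅ t = f -> f ⋅ t = t -> u ⋅ f = u ->
  f ⋅ f = f -> 0 < i < j -> pow t i = pow t j -> t ⋅ u = f.
Proof.
move=> ut ft uf ff /andP[i0 ij].
have upow k : 0 < k -> u ⋅ pow t k.+1 = pow t k.
  move=> k0; rewrite powS // opA ut; case: k k0 => // k _.
  by elim: k => [|k IH] //; rewrite (powSr t (ltn0Sn k)) opA IH.
have -> : j = i.-1.+1 + (j - i) by lia.
have : 0 < j - i by lia.
have -> : i = i.-1.+1 by lia.
move: (j - _) => d d0; elim: i.-1 => [|k IH] e; last first.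
  by apply: IH; rewrite -upow // e addSn upow.
have fd : f = pow t d by rewrite -upow // -add1n -e.
(* Doubling [d] keeps the exponent of [u] positive when [d = 1]. *)
have fdd : f = pow t (d + d).-1.+1 by rewrite -ff fd -powD // prednK //; lia.
have -> : u = pow t (d + d).-1 by rewrite -uf fdd upow //; lia.
by rewrite -powS //; lia.
Qed.

(** If some [q ⊙ p] were free, minimality would give [M ⊙ p = M], hence an idempotent [f] fixing [p]
    and an [x] with [x ⊙ p = f]. As [f] is principal, [p] turns out principal whether or not [M ⊙ f]
    has a free element. *)
Lemma free_right_ideal_principal D : usemigroup D -> D `&` free !=set0 ->
    (forall f, D f -> f ⊙ f = f -> ~ free f) ->
  exists M p, [/\ usemigroup M, M p, free p & forall q, M q -> ~ free (q ⊙ p)].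
Proof.
move=> Dsg Dfree noidem.
have [M [Msg MD [p [Mp pf]] Mmin]] := minimal_usemigroup uclosed_free Dsg Dfree.
have pU := pf.1; have [[MU _] Mm] := Msg.
exists M, p; split=> // q Mq qpf.
have Mabsorb r : M r -> [set q ⊙ r | q in M] `&` free !=set0 ->
    M `<=` [set q ⊙ r | q in M].
  by move=> Mr h; have [sg sub] := usemigroup_mulr Msg Mr; apply: Mmin.
have MMp : M `<=` [set q ⊙ p | q in M].
  by apply: Mabsorb => //; exists (q ⊙ p); split=> //; exists q.
have [f [Mf fp] ff] : exists2 f, M f /\ f ⊙ p = p & f ⊙ f = f.
  apply: (usemigroup_idempotent (usemigroup_stabilizer Msg pU)).
  by have [x Mx xp] := MMp _ Mp; exists x.
have [f0 ef] := not_free_principal (MU _ Mf) (noidem _ (MD _ Mf) ff).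
have [x' Mx' x'p] := MMp _ Mf.
pose x := f ⊙ x'.
have Mx : M x by apply: Mm.
have fx : f ⊙ x = x by rewrite /x umulA ff.
have xp : x ⊙ p = f by rewrite /x -umulA x'p.
have [Mff|nMff] := pselect ([set q ⊙ f | q in M] `&` free !=set0).
  (* Here [M ⊙ f = M], so [p ⊙ f = p], and [p ⊙ x] is an idempotent, hence a point [g]. *)
  have [r Mr rf] := Mabsorb _ Mf Mff _ Mp.
  have pfp : p ⊙ f = p by rewrite -rf -umulA ff.
  have pxI : p ⊙ x ⊙ (p ⊙ x) = p ⊙ x by rewrite -umulA (umulA x) xp fx.
  have Mpx : M (p ⊙ x) by apply: Mm.
  have [g eg] := not_free_principal (MU _ Mpx) (noidem _ (MD _ Mpx) pxI).
  have pxg : (p ⊙ x) [set g] by rewrite eg.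
  (* One point [s] with [s x = g] suffices: [p = p x p = g p = s x p = s f] is principal. *)
  have [s hs] := @filter_ex _ p _ _ pxg.
  have sx : principal s ⊙ x = principal g.
    by apply: principalP => //; apply: umul_ultra (MU _ Mx); exact: principal_ultra.
  apply: (free_not_principal (x := s ⋅ f0) pf).
  by rewrite -umul_principal -ef -xp umulA sx -eg -umulA xp pfp.
have Mf_principal r : M r -> exists s, r ⊙ f = principal s.
  move=> Mr; apply: not_free_principal => [|h]; first by apply: MU; apply: Mm.
  by apply: nMff; exists (r ⊙ f); split=> //; exists r.
have [t0 et] := Mf_principal _ Mp; have [u0 eu] := Mf_principal _ Mx.
have ut : u0 ⋅ t0 = f0.
  by apply: principal_inj; rewrite -umul_principal -eu -et -ef -umulA (umulA f) fp umulA xp.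
have ft : f0 ⋅ t0 = t0.
  by apply: principal_inj; rewrite -umul_principal -et -ef umulA fp.
have uf : u0 ⋅ f0 = u0.
  by apply: principal_inj; rewrite -umul_principal -eu -ef -umulA ff.
have ff0 : f0 ⋅ f0 = f0 by apply: principal_inj; rewrite -umul_principal -ef.
have [sgf _] := usemigroup_mulr Msg Mf.
(* The powers of [t0], which is [p ⊙ f], stay in the closed set [M ⊙ f] without free elements, so
   two of them coincide. *)
have [r hr|n|i [j [ij e]]] :=
    @uclosed_not_free_repeats [set q ⊙ f | q in M] (fun n => pow t0 n.+1) sgf.1.
- by move=> rf; apply: nMff; exists r.
- elim: n => [|n IH]; first by exists p.
  rewrite powS // -umul_principal; apply: sgf.2 => //.
  by exists p.
(* The left inverse [u0] is two-sided, so [p = f p = t0 u0 p = t0 f] is principal. *)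
apply: (free_not_principal (x := t0 ⋅ f0) pf).
have tu : t0 ⋅ u0 = f0 by apply: (left_inverse_power ut ft uf ff0 _ e); rewrite /=; lia.
have up : principal u0 ⊙ p = f by rewrite -eu -umulA fp xp.
have tuf : principal t0 ⊙ principal u0 = f by rewrite umul_principal tu -ef.
by rewrite -[LHS]fp -tuf -umulA up ef umul_principal.
Qed.

(** * A free ultrafilter with principal higher powers *)

Section PrincipalPowers.
Variables (M : set (set_system S)) (p : set_system S).
Hypotheses (Msg : usemigroup M) (Mp : M p) (pf : free p).
Hypothesis Mp_principal : forall q, M q -> ~ free (q ⊙ p).

Let upow k := iter k.-1 (fun q => q ⊙ p) p.

Let upowS k : 0 < k -> upow k.+1 = upow k ⊙ p.
Proof. by case: k. Qed.

Let upow_in k : M (upow k).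
Proof. by rewrite /upow; elim: k.-1 => //= n IH; apply: Msg.2. Qed.

Let upowD k l : 0 < k -> 0 < l -> upow (k + l) = upow k ⊙ upow l.
Proof.
move=> k0; elim: l => // -[|l] IH _; first by rewrite addn1 upowS.
by rewrite addnS upowS ?addnS // -addnS IH // -umulA -upowS.
Qed.

(** The higher powers lie in the closed set [M ⊙ p], which has no free element, so they are points
    that repeat. The last two clauses transfer products with [p] to [p]-almost all points [s]. *)
Lemma principal_powers : exists z : nat -> S, exists i j,
  [/\ 2 <= i < j, forall k, i <= k -> z (k + (j - i)) = z k,
    forall k l, 2 <= k -> 2 <= l -> z k ⋅ z l = z (k + l),
    p [set s | p [set t | s ⋅ t = z 2]] &
    p [set s | forall k, 2 <= k -> s ⋅ z k = z k.+1 /\ z k ⋅ s = z k.+1]].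
Proof.
have pU := pf.1.
have /choice[z hz] k : exists s, 2 <= k -> upow k = principal s.
  have [s0 _] := filter_ex (@filterT _ p _).
  case: (leqP 2 k) => k2; last by exists s0.
  have nf : ~ free (upow k).
    by case: k k2 => // k k2; rewrite upowS; [apply: Mp_principal|lia].
  by have [s e] := not_free_principal (Msg.1.1 _ (upow_in k)) nf; exists s.
have zD k l : 2 <= k -> 2 <= l -> z k ⋅ z l = z (k + l).
  move=> k2 l2; apply: principal_inj; rewrite -umul_principal -!hz //; last by lia.
  by rewrite upowD //; lia.
have zp k : 2 <= k -> principal (z k) ⊙ p = principal (z k.+1).
  by move=> k2; rewrite -!hz ?upowS //; lia.
have pz k : 2 <= k -> p ⊙ principal (z k) = principal (z k.+1).
  by move=> k2; rewrite -!hz -?[k.+1]add1n ?upowD //; lia.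
have [||n|i' [j' [ij e]]] :=
    @uclosed_not_free_repeats [set q ⊙ p | q in M] (fun n => z n.+2).
- exact: (usemigroup_mulr Msg Mp).1.1.
- by move=> _ [q Mq <-]; apply: Mp_principal.
- by exists (upow n.+1) => //; rewrite -upowS // hz.
pose i := i'.+2; pose j := j'.+2.
have per k : i <= k -> z (k + (j - i)) = z k.
  elim: k => // k IH; rewrite leq_eqVlt => /orP[/eqP <-|ik].
    by rewrite subnKC; [|rewrite /i /j; lia]; rewrite /i /j e.
  by apply: principal_inj; rewrite addSn -!zp ?IH //; rewrite /i in ik; lia.
exists z, i, j; split=> //.
  have h : (p ⊙ p) [set z 2] by rewrite -[p ⊙ p]/(upow 2) hz.
  exact: h.
(* The filter handles finitely many exponents at once; periodicity reduces all of them to those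
   below [j]. *)
have fin m : p [set s | forall k, 2 <= k < m -> s ⋅ z k = z k.+1 /\ z k ⋅ s = z k.+1].
  elim: m => [|m IH]; first by apply: filterE => s k; lia.
  have [m2|m2] := ltnP m 2.
    by apply: filterE => s k; lia.
  have h1 : (p ⊙ principal (z m)) [set z m.+1] by rewrite pz.
  have h2 : (principal (z m) ⊙ p) [set z m.+1] by rewrite zp.
  apply: filterS (filterI IH (@filterI _ p _ _ _ h1 h2)) => s [hs [s1 s2]] k /andP[k2].
  by rewrite ltnS leq_eqVlt => /orP[/eqP->|km] //; apply: hs; lia.
apply: filterS (fin j) => s hs; elim/ltn_ind => k IH k2.
have [kj|jk] := ltnP k j; first by apply: hs; lia.
have ik : i <= k - (j - i) by rewrite /i /j in jk *; lia.
have -> : k = k - (j - i) + (j - i) by rewrite /i /j in jk *; lia.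
rewrite -addSn !per //; [|lia].
by apply: IH; rewrite /i /j in ik jk *; lia.
Qed.

Lemma principal_powers_has_sub :
  has_sub_type_a op \/ has_sub_fan op \/ has_sub_C op.
Proof.
have pU := pf.1.
have [z [i [j [ij per zz pz2 pX]]]] := principal_powers.
pose X s := forall k, 2 <= k -> s ⋅ z k = z k.+1 /\ z k ⋅ s = z k.+1.
have Xz s k : X s -> 2 <= k -> s ⋅ z k = z k.+1 by move=> Xs /Xs[].
have zX s k : X s -> 2 <= k -> z k ⋅ s = z k.+1 by move=> Xs /Xs[].
pose W := [set s | X s /\ p [set t | s ⋅ t = z 2]].
have pW : p W by exact: (filterI pX pz2).
have zfin : finite_set (fun u => exists k, 2 <= k /\ u = z k).
  have := @periodic_range_finite _ z i j; case/andP: ij => _ ij /(_ ij per).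
  by apply: finite_sub => u [k [_ ->]]; exists k.
(* A product of two elements of [X] raises the index of [z k] by 2, so the [z k] absorb [T]. *)
have type_a (T : set S) : ~ finite_set T ->
    (forall x y, T x -> T y -> x ⋅ y = z 4) ->
    (forall x, T x -> exists t s, [/\ X t, X s & x = t ⋅ s]) -> has_sub_type_a op.
  move=> Tinf TT TX; apply: (has_sub_type_a_of Tinf zfin).
  - by move=> x y Tx Ty; exists 4; rewrite TT.
  - move=> x _ Tx [k [k2 ->]]; have [t [s [Xt Xs ->]]] := TX _ Tx; exists k.+2.
    by split; rewrite ?(leqW (leqW k2)) // -opA !Xz // leqW.
  - move=> _ x [k [k2 ->]] Tx; have [t [s [Xt Xs ->]]] := TX _ Tx; exists k.+2.
    by split; rewrite ?(leqW (leqW k2)) // opA !zX // leqW.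
  - by move=> _ _ [k [k2 ->]] [l [l2 ->]]; exists (k + l); split; [lia|exact: zz].
have [[s [[Xs ps] psf]]|h] := pselect (exists s, W s /\ free (p ⊙ principal s)).
  left; apply: (type_a [set y | exists t, [/\ X t, s ⋅ t = z 2 & y = t ⋅ s]]).
  - have pT : p [set t | exists t', [/\ X t', s ⋅ t' = z 2 & t ⋅ s = t' ⋅ s]].
      by apply: filterS (filterI pX ps) => t [Xt st]; exists t.
    exact: (free_infinite psf pT).
  - move=> _ _ [t [Xt st ->]] [t' [Xt' st' ->]].
    by rewrite opA -(opA t) st' Xz // zX.
  - by move=> _ [t [Xt _ ->]]; exists t, s.
have /choice[r hr] s : exists r, W s -> p [set t | t ⋅ s = r].
  have [Ws|nW] := pselect (W s); last by exists s.
  have psU : UltraFilter (p ⊙ principal s) by apply: umul_ultra => //; exact: principal_ultra.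
  have [f|r e] := not_free_principal psU _; first by apply: h; exists s.
  have psr : (p ⊙ principal s) [set r] by rewrite e.
  by exists r.
(* The image of [p] under [r]; if it is free, the values [r s] are infinitely many. *)
pose P : set_system S := [set A | p [set s | A (r s)]].
have PU : UltraFilter P.
  by apply: ultra_of_dichotomy => A; exact: (in_ultra_setVsetC [set s | A (r s)] pU).
have factor s : W s -> exists t, W t /\ t ⋅ s = r s.
  by move=> Ws; have [t [Wt ts]] := filter_ex (filterI pW (hr _ Ws)); exists t.
have [Pf|/(not_free_principal PU)[r0 Pr0]] := pselect (free P).
  left; apply: (type_a [set y | exists s, W s /\ y = r s]).
  - have pT : p [set s | exists s', W s' /\ r s = r s'].
      by apply: filterS pW => s Ws; exists s.
    exact: (free_infinite Pf pT).
  - move=> _ _ [s [Ws ->]] [s' [Ws' ->]]; have [t [Wt <-]] := factor _ Ws.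
    (* The factor [t'] of [r s'] is chosen after [s], so that the inner product [s ⋅ t'] is
       [z 2]. *)
    have [t' [st' <-]] := filter_ex (filterI Ws.2 (hr _ Ws')).
    by rewrite opA -(opA t) st' Xz ?zX //; [exact: Ws'.1|exact: Wt.1].
  - move=> _ [s [Ws ->]]; have [t [Wt <-]] := factor _ Ws; exists t, s.
    by split=> //; [exact: Wt.1|exact: Ws.1].
have pr0 : p [set s | r s = r0] by change (P [set r0]); rewrite Pr0.
pose Y := [set s | W s /\ p [set t | t ⋅ s = r0]].
have pY : p Y by apply: filterS (filterI pW pr0) => s [Ws /= rs];
  split=> //; rewrite -rs; exact: hr.
(* Products of generic points are now constant in either order, [z 2] or [r0]. *)
have [l Yl|x [xY xR]] :=
    @chain_exists S Y (fun s t => [/\ s ⋅ t = z 2, t ⋅ s = r0 & s <> t]).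
  have : p [set t | forall s, In s l -> [/\ s ⋅ t = z 2, t ⋅ s = r0 & s <> t]].
    elim: l Yl => [|s l IH] Yl; first exact: filterE.
    have {}IH := IH (fun y hy => Yl y (or_intror hy)).
    have [[_ s1] s2] := Yl s (or_introl erefl).
    apply: filterS (filterI (filterI s1 s2) (filterI (pf.2 s) IH)).
    by move=> t [[st ts] [nst ht]] y [<-|/ht//]; split=> // e; apply: nst.
  by move=> h'; have [t [Yt ht]] := filter_ex (filterI pY h'); exists t.
have Yr0 y : Y y -> y ⋅ r0 = z 3.
  move=> [[_ yz] _]; have [s Ys] := filter_ex pY.
  (* [r0] is factored as [t ⋅ s] with [y ⋅ t = z 2]. *)
  have [t [yt <-]] := filter_ex (filterI yz Ys.2).
  by rewrite opA yt zX //; exact: Ys.1.1.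
have YX y : Y y -> X y by move=> [[]].
have r0Y y : Y y -> r0 ⋅ y = z 3.
  move=> Yy; have [s [Ys sy]] := filter_ex (filterI pY Yy.2).
  have [t [Yt <-]] := filter_ex (filterI pY Ys.2).
  by rewrite -opA sy Yr0.
have [s0 Ys0] := filter_ex pY.
have [t0 [Yt0 /esym r0ts]] := filter_ex (filterI pY Ys0.2).
have [Xt0 Xs0] := (YX _ Yt0, YX _ Ys0).
apply: (@collapsing_has_sub x z r0 i j _ ij per); split.
- by apply: injective_lt => m n /xR[].
- move=> n m nm; have [lt|lt] : n < m \/ m < n by lia.
    by left; case: (xR _ _ lt).
  by right; case: (xR _ _ lt).
- by move=> n k; apply: Xz; apply: YX.
- by move=> n k; apply: zX; apply: YX.
- by move=> n; apply: Yr0.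
- by move=> n; apply: r0Y.
- exact: zz.
- by rewrite {2}r0ts opA r0Y // zX.
- by move=> k k2; rewrite r0ts -opA !Xz // leqW.
- by move=> k k2; rewrite r0ts opA !zX // leqW.
Qed.
End PrincipalPowers.

(** * The Galvin-Glazer construction *)

Lemma filter_forall_In (T : Type) (p : set_system S) (l : list T) (A : T -> set S) :
  Filter p -> (forall y, In y l -> p (A y)) -> p [set x | forall y, In y l -> A y x].
Proof.
move=> pF; elim: l => [|y l IH] h; first by apply: filterE => x y [].
apply: filterS (filterI (h y (or_introl erefl)) (IH (fun y' hy' => h y' (or_intror hy')))).
by move=> x [Ay hl] y' [<-|/hl].
Qed.

Lemma ultra_finite_coloring (p : set_system S) (C : finType) (c : S -> C) :
  UltraFilter p -> exists i, p [set x | c x = i].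
Proof.
move=> pU; apply: contrapT => /forallNP h.
have /filter_ex[x /(_ (c x))] : p [set x | forall i, In i (enum C) -> c x <> i].
  by apply: filter_forall_In => i _; exact: ultraC (h i).
apply=> //; have : c x \in enum C by rewrite mem_enum.
by elim: (enum C) => //= i s IH; rewrite inE => /orP[/eqP->|/IH]; [left|right].
Qed.

(* A stage (A, F, E) of the Galvin-Glazer construction: A is the large set in
   which all sums starting at a_F will lie, and E lists the earlier sums, which
   A avoids so that the sumsequence becomes proper. *)
Lemma galvin_glazer (a : nat -> S) (p : set_system S) (C : finType) (c : S -> C) :
    free p -> p ⊙ p = p -> (forall n, p (FS_from a n)) ->
  exists F, [/\ sumseq_blocks F, proper_seq op (sumseq op a F) &
    monochromatic c (FS op (sumseq op a F))].
Proof.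
move=> pf pp pFS; have pU := pf.1.
have [col pcol] := ultra_finite_coloring c pU.
pose stage := (set S * blk * list S)%type.
pose bs (t : stage) := blk_sum op a t.1.2.
pose P (t : stage) := [/\ valid_blk t.1.2 /\ p t.1.1,
  t.1.1 (bs t), p [set x | t.1.1 (bs t ⋅ x)],
  (forall x, t.1.1 x -> c x = col) & (forall x, t.1.1 x -> ~ In x t.2)].
pose R (t u : stage) := [/\ blk_lt t.1.2 u.1.2, u.1.1 `<=` t.1.1,
  (forall x, u.1.1 x -> t.1.1 (bs t ⋅ x)), In (bs t) u.2 &
  (forall e, In e t.2 -> In e u.2 /\ In (e ⋅ bs t) u.2)].
have [l Pl|t [tP tR]] := @chain_exists stage P R.
  (* The sums known after stage [t]: its own, the listed ones, and the listed ones extended by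
     it. *)
  pose next t := (bs t :: t.2 ++ List.map (fun e => e ⋅ bs t) t.2)%list.
  pose E := List.flat_map next l.
  have [m hm] := nat_list_bound (List.map (fun t : stage => blk_max t.1.2) l).
  pose A := [set x | [/\ c x = col, ~ In x E, FS_from a m.+1 x &
    forall t, In t l -> t.1.1 x /\ t.1.1 (bs t ⋅ x)]].
  have pA : p A.
    have pE : p [set x | forall y, In y E -> x <> y].
      by apply: filter_forall_In => y _; exact: pf.2.
    have pl : p [set x | forall t, In t l -> t.1.1 x /\ t.1.1 (bs t ⋅ x)].
      by apply: filter_forall_In => t /Pl[[_ pt] _ pt' _ _]; exact: filterI.
    apply: filterS (filterI (filterI pcol pE) (filterI (pFS m.+1) pl)).
    by move=> x [[cx Ex] [Fx lx]]; split=> // /Ex.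
  (* Idempotence makes [p]-almost every translate of [A] large again, which the next stages need. *)
  have pA2 : p [set s | p [set x | A (s ⋅ x)]] by rewrite -pp in pA.
  have [s [As ps]] := filter_ex (filterI pA pA2).
  have [_ _ [F [Fv mF sF]] _] := As.
  exists (A, F, E); split.
    by split; rewrite /bs /= -?sF // => x [].
  move=> t tl; split=> /=.
  - by apply: leq_trans mF; rewrite ltnS; apply: hm; apply/in_map_iff; exists t.
  - by move=> x [_ _ _ /(_ t tl)[]].
  - by move=> x [_ _ _ /(_ t tl)[]].
  - by apply/in_flat_map; exists t; split=> //; left.
  - move=> e he; split; apply/in_flat_map; exists t; split=> //; right; apply/in_app_iff.
      by left.
    by right; apply/in_map_iff; exists e.
pose F n := (t n).1.2; pose b := sumseq op a F.
have inA i s : valid_blk (i, s) -> (t i).1.1 (blk_sum op b (i, s)).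
  elim: s i => [|j s IH] i; first by move=> _; case: (tP i).
  rewrite blk_sum_cons {1}/valid_blk /= => /andP[ij /IH hj].
  by have [_ _ h _ _] := tR _ _ ij; exact: h.
have inE i s n : valid_blk (i, s) -> blk_max (i, s) < n -> In (blk_sum op b (i, s)) (t n).2.
  elim/last_ind: s n => [|s j IH] n; first by rewrite /blk_max /= => _ /tR[].
  rewrite blk_sum_rcons /blk_max /valid_blk /= rcons_path last_rcons.
  move=> /andP[sv sj] /tR[_ _ _ _ hE].
  by have [] := hE _ (IH j sv sj).
exists F; split.
- split=> n; first by have [[]] := tP n.
  by have [] := tR n n.+1 (ltnSn n).
(* The later sum lies in a set avoiding the list that contains the earlier sum. *)
- move=> [i s] [j u] Gv Hv GH e; have [_ _ _ _ hE] := tP j.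
  by apply: (hE _ (inA _ _ Hv)); rewrite -e; exact: inE.
- have mono x : FS op b x -> c x = col.
    move=> [[i s] [Gv ->]]; have [_ _ _ hc _] := tP i; exact: hc (inA _ _ Gv).
  by move=> x y /mono-> /mono->.
Qed.

Lemma proper_monochromatic_sumseq (a : nat -> S) (C : finType) (c : S -> C) :
    ~ has_sub_type_a op -> ~ has_sub_fan op -> ~ has_sub_C op -> injective a ->
  exists F, sumseq_blocks F /\ proper_seq op (sumseq op a F) /\
    monochromatic c (FS op (sumseq op a F)).
Proof.
move=> na nb nc aI.
pose D := [set q : set_system S | UltraFilter q /\ forall n, q (FS_from a n)].
have Dsg : usemigroup D.
  split; first split=> [q []//|q qU h].
    by split=> // n; apply: h => r [].
  move=> q r [qU hq] [rU hr]; split=> [|n]; first exact: umul_ultra.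
  apply: filterS (hq n) => _ [F [Fv nF ->]].
  (* The second factor is taken in the tail beyond the block of the first. *)
  by apply: filterS (hr (blk_max F).+1) => x /FS_from_mul; exact.
have Df : D `&` free !=set0.
  have [p [pf ptail]] := free_tail_exists aI; have pU := pf.1.
  exists p; split=> //; split=> // n; apply: filterS (ptail n) => _ [k [nk ->]].
  by exists (k, [::]).
have [[f [[fU fFS] ff ffree]]|h] := pselect (exists f, [/\ D f, f ⊙ f = f & free f]).
  by have [F []] := galvin_glazer c ffree ff fFS; exists F.
have [|M [p [Msg Mp pf Mpr]]] := free_right_ideal_principal Dsg Df.
  by move=> f Df' ff ffree; apply: h; exists f.
by have [|[|]] := principal_powers_has_sub Msg Mp pf Mpr.
Qed.
End Semigroup.

(** * The equivalences *)

Theorem theorem3p4 (S : Type) (op : S -> S -> S) (Hassoc : associative op) :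
  let P1 := forall A : S -> Prop, proper_IP_set op A ->
      forall (C : finType) (c : S -> C),
        exists i : C, proper_IP_set op (fun x => A x /\ c x = i) in
  let P2 := forall a : nat -> S, injective a ->
      exists F : nat -> blk, sumseq_blocks F /\ proper_seq op (sumseq op a F) in
  let P3 := ~ has_sub_type_a op /\ ~ has_sub_fan op /\ ~ has_sub_C op in
  let P4 := forall a : nat -> S, injective a ->
      forall (C : finType) (c : S -> C),
        exists F : nat -> blk, sumseq_blocks F /\ injective (sumseq op a F) /\
          monochromatic c (FS op (sumseq op a F)) in
  let P5 := forall a : nat -> S, injective a ->
      forall (C : finType) (c : S -> C),
        exists F : nat -> blk, sumseq_blocks F /\ proper_seq op (sumseq op a F) /\
          monochromatic c (FS op (sumseq op a F)) in
  (P1 <-> P2) /\ (P1 <-> P3) /\ (P1 <-> P4) /\ (P1 <-> P5).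
Proof.
move=> P1 P2 P3 P4 P5.
(* The implications run through [P1], [P3], [P5], [P4] and back to [P1], with [P2] inserted between
   [P5] and [P3]. *)
have no_sub : (forall a L, injective a -> finite_set L -> almost_null op a L -> False) -> P3.
  move=> h; have {}h : ~ (has_sub_type_a op \/ has_sub_fan op \/ has_sub_C op).
    by move=> /(has_sub_almost_null Hassoc)[a [L [aI Lfin aL]]]; apply: (h a L).
  by split; [|split] => ?; apply: h; auto.
have h13 : P1 -> P3.
  by move=> h1; apply: no_sub => a L aI Lfin /(almost_null_not_partition_regular aI Lfin).
have h23 : P2 -> P3.
  by move=> h2; apply: no_sub => a L aI Lfin
    /(almost_null_no_proper_sumseq Hassoc Lfin); apply; exact: h2.
have h35 : P3 -> P5.
  by move=> [na [nb nc]] a aI C c; exact: (proper_monochromatic_sumseq Hassoc).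
(* A colouring with one colour leaves only properness. *)
have h52 : P5 -> P2.
  by move=> h5 a /h5/(_ unit (fun=> tt))[F [Fb [Fp _]]]; exists F.
have h54 : P5 -> P4.
  move=> h5 a aI C c; have [F [Fb [Fp Fm]]] := h5 a aI C c.
  by exists F; split=> //; split=> //; exact: proper_seq_injective Fp.
have h41 : P4 -> P1.
  move=> h4 A [b [bI bA]] C c; have [F [Fb [FI Fm]]] := h4 b bI C c.
  exists (c (sumseq op b F 0)), (sumseq op b F); split=> // x hx; split.
    by apply/bA/(FS_sumseq Hassoc Fb).
  by apply: Fm => //; exists (0, [::]).
have h34 := h54 \o h35; have h51 := h41 \o h54.
by split; [|split; [|split]]; split=> h; auto.
Qed.
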